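(* Let $\bar S\in\mathbb S(L)$ be a market. Let $\mathcal U$ be a utility functional on $L$ that is normalized ($\mathcal U(0)=0$) and satisfies the upper Fatou property, and let $\mathcal R$ be a risk functional on $L$ that is cash-additive, positively star-shaped and satisfies the lower Fatou property. Consider the following statements: (a) $\mathcal U$ satisfies robust ASLL on $\bar S$, or $\mathcal R$ satisfies SLL on $\bar S$. (b) $(\mathcal U,\mathcal R)$-terminal-wealth portfolio selection is weakly well posed for $\bar S$. (c) $\mathcal U$ satisfies robust SLL on $\bar S$, or $\mathcal R$ satisfies SLL on $\bar S$. (d) $(\mathcal U,\mathcal R)$-terminal-wealth portfolio selection is well posed for $\bar S$. Then (a) implies (b), and (c) implies (d). If, in addition, $\mathcal R$ is aligned with $\mathcal U$ on $\bar S$, then all four statements are equivalent.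
   Context: Setting. $(\Omega,\mathcal F,\mathbb P)$ is an atomless probability space. $L$ is a Riesz space of random variables (vector lattice for the $\mathbb P$-a.s. order) with $L^\infty\subset L\subset L^1$, which is law-invariant: if $Y\in L$ and $Z$ is a random variable on $(\Omega,\mathcal F,\mathbb P)$ with the same law as $Y$, then $Z\in L$. Constants are identified with constant random variables. A utility functional is a map $\mathcal U:L\to[-\infty,\infty)$ that is increasing ($Y\le Z$ a.s. implies $\mathcal U(Y)\le\mathcal U(Z)$), satisfies $\mathcal U(c)\in\mathbb R$ for all constants $c>0$, and $\mathcal U(Y)<\mathcal U(\infty):=\lim_{y\to\infty}\mathcal U(y)$ for all $Y\in L$. A risk functional is a map $\mathcal R:L\to(-\infty,\infty]$ that is decreasing ($Y\le Z$ a.s. implies $\mathcal R(Y)\ge\mathcal R(Z)$) with $\mathcal R(c)\in\mathbb R$ for all constants $c>0$. Properties. Cash-additive: $\mathcal R(Y+c)=\mathcal R(Y)+\mathcal R(c)$ for $Y\in L$, $c\in\mathbb R$. Positively star-shaped: $\mathcal R(\lambda Y)\ge\lambda\mathcal R(Y)$ for $Y\in L$, $\lambda\in(1,\infty)$ (equivalently $\mathcal R(\lambda Y)\le\lambda\mathcal R(Y)$ for $\lambda\in(0,1)$). Upper (resp. lower) Fatou property: $\mathcal H(Y)\ge\limsup_n\mathcal H(Y_n)$ (resp. $\mathcal H(Y)\le\liminf_n\mathcal H(Y_n)$) whenever $Y_n,Y\in L$, $Y_n\to Y$ a.s. and $|Y_n|\le Z$ a.s. for all $n$, for some $Z\in L$.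 Markets. $\mathbb S(L)$ is the set of all $\bar S=(S^0_t,\dots,S^d_t)_{t\in\{0,1\}}$, $d\in\mathbb N$, with $S^i_0=1$ for all $i$, $S^0_1=1+r$ for some $r\in(-1,\infty)$ (the risk-free rate), $S^i_1\in L$, that are arbitrage-free (there is no $\bar\theta\in\mathbb R^{1+d}$ with $\bar\theta\cdot\bar S_0\le0$, $\bar\theta\cdot\bar S_1\ge0$ a.s. and $\mathbb P[\bar\theta\cdot\bar S_1>0]>0$) and non-redundant ($S^0_1,\dots,S^d_1$ are linearly independent in $L$). Problem. For $w\in(0,\infty)$ and $R_{\max}\in[\mathcal R(w(1+r)),\infty)$, $(\mathcal U,\mathcal R)$-terminal-wealth portfolio selection is: maximize $\mathcal U(\bar\theta\cdot\bar S_1)$ over $\bar\theta\in\mathbb R^{1+d}$ with $\bar\theta\cdot\bar S_0=w$ and $\mathcal R(\bar\theta\cdot\bar S_1)\le R_{\max}$. It is well posed for $\bar S$ if for every such $w$ and $R_{\max}$ a maximizer exists; it is weakly well posed for $\bar S$ if for every such $w$ and $R_{\max}$ the supremum is strictly less than $\mathcal U(\infty)$. Large-loss notions. Below, $\bar\eta$ ranges over non-zero zero-cost portfolios, i.e. $\bar\eta\in\mathbb R^{1+d}\setminus\{\mathbf 0\}$ with $\bar\eta\cdot\bar S_0=0$. - $\mathcal R$ satisfies SLL on $\bar S$ if for every $\bar\eta$ there is $\lambda_{\bar\eta}\in(0,\infty)$ with $\mathcal R(\lambda\,\bar\eta\cdot\bar S_1)>0$ for all $\lambda>\lambda_{\bar\eta}$.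 - $\mathcal U$ satisfies robust ASLL on $\bar S$ if for every $\bar\eta$ and every $Y\in L$ there is $\varepsilon_{\bar\eta,Y}>0$ with $\limsup_{\lambda\to\infty}\mathcal U(\lambda(\bar\eta\cdot\bar S_1+\varepsilon Y))<\mathcal U(\infty)$ for all $\varepsilon\in(0,\varepsilon_{\bar\eta,Y})$. - $\mathcal U$ satisfies robust SLL on $\bar S$ if for every $\bar\eta$ and every $Y\in L$ there are $\varepsilon_{\bar\eta,Y}>0$ and $\lambda_{\bar\eta,Y}\in(0,\infty)$ with $\mathcal U(\lambda(\bar\eta\cdot\bar S_1+\varepsilon Y))<0$ for all $\lambda>\lambda_{\bar\eta,Y}$ and $\varepsilon\in(0,\varepsilon_{\bar\eta,Y})$. - $\mathcal R$ is aligned with $\mathcal U$ on $\bar S$ if for every $\bar\eta$: $\mathcal R(\lambda\,\bar\eta\cdot\bar S_1)\le0$ for all $\lambda>0$ implies $\lim_{\lambda\to\infty}\mathcal U(\lambda\,\bar\eta\cdot\bar S_1)=\mathcal U(\infty)$. *)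

(* Defs.v *)
From HB Require Import structures.
From mathcomp Require Import all_boot all_order all_algebra.
From mathcomp Require Import all_classical all_reals all_analysis.
From mathcomp Require Import measurable_realfun.

Set Implicit Arguments.
Unset Strict Implicit.
Unset Printing Implicit Defensive.
Import Order.TTheory GRing.Theory Num.Theory.
Import numFieldNormedType.Exports.
Local Open Scope classical_set_scope.
Local Open Scope ring_scope.

Section Setting.
Context (dT : measure_display) (T : measurableType dT) (R : realType)
  (P : probability T R).

Definition atomless : Prop :=
  forall A : set T, measurable A -> (0 < P A)%E ->
    exists B : set T,
      [/\ measurable B, B `<=` A, (0 < P B)%E & (P B < P A)%E].

(* Random variables are represented by measurable functions rather than by
   almost-sure equivalence classes. Equality and order of random variables are
   therefore taken almost surely; a law-invariant set is saturated for
   almost-sure equality, and a monotone functional is compatible with it. *)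
Local Notation RV := {RV P >-> R}.

Definition const_rv (c : R) : RV := cst c.

Definition as_eq (Y Z : RV) : Prop := {ae P, forall x, Y x = Z x}.

Definition as_le (Y Z : RV) : Prop := {ae P, forall x, Y x <= Z x}.

Definition linear_subspace (L : set RV) : Prop :=
  L 0 /\ forall (a : R) (Y Z : RV), L Y -> L Z -> L (a *: Y + Z).

Definition as_lub (L : set RV) (Y Z W : RV) : Prop :=
  [/\ L W, as_le Y W, as_le Z W &
    forall V : RV, L V -> as_le Y V -> as_le Z V -> as_le W V].

Definition as_glb (L : set RV) (Y Z W : RV) : Prop :=
  [/\ L W, as_le W Y, as_le W Z &
    forall V : RV, L V -> as_le V Y -> as_le V Z -> as_le V W].

Definition riesz_space (L : set RV) : Prop :=
  linear_subspace L /\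
  forall Y Z : RV, L Y -> L Z ->
    (exists W, as_lub L Y Z W) /\ (exists W, as_glb L Y Z W).

Definition same_law (Y Z : RV) : Prop :=
  forall A : set R, measurable A -> distribution P Y A = distribution P Z A.

Definition law_invariant (L : set RV) : Prop :=
  forall Y Z : RV, L Y -> same_law Y Z -> L Z.

Record rv_space (L : set RV) : Prop := {
  rv_space_riesz : riesz_space L;
  rv_space_Linfty :
    forall Y : RV, (Y : T -> R) \in Lfun P +oo%E -> L Y;
  rv_space_L1 :
    forall Y : RV, L Y -> (Y : T -> R) \in Lfun P 1%:E;
  rv_space_law_invariant : law_invariant L }.

Section Functionals.
Variable L : set RV.

(* Functionals on L are functions on all random variables of which only the
   values on L are ever constrained or used. *)

Definition utility_at_infty (U : RV -> \bar R) : \bar R :=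
  lim (U (const_rv y) @[y --> +oo]).

Record utility_functional (U : RV -> \bar R) : Prop := {
  utility_lty : forall Y : RV, L Y -> (U Y < +oo)%E;
  utility_increasing :
    forall Y Z : RV, L Y -> L Z -> as_le Y Z -> (U Y <= U Z)%E;
  utility_const_fin :
    forall c : R, 0 < c -> U (const_rv c) \is a fin_num;
  utility_lt_infty :
    forall Y : RV, L Y -> (U Y < utility_at_infty U)%E }.

Record risk_functional (Rho : RV -> \bar R) : Prop := {
  risk_gtNy : forall Y : RV, L Y -> (-oo < Rho Y)%E;
  risk_decreasing :
    forall Y Z : RV, L Y -> L Z -> as_le Y Z -> (Rho Z <= Rho Y)%E;
  risk_const_fin :
    forall c : R, 0 < c -> Rho (const_rv c) \is a fin_num }.

Definition normalized (H : RV -> \bar R) : Prop := H (const_rv 0) = 0%E.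

Definition cash_additive (Rho : RV -> \bar R) : Prop :=
  forall (Y : RV) (c : R), L Y ->
    Rho (Y + const_rv c) = (Rho Y + Rho (const_rv c))%E.

Definition positively_star_shaped (Rho : RV -> \bar R) : Prop :=
  forall (Y : RV) (l : R), L Y -> 1 < l ->
    (l%:E * Rho Y <= Rho (l *: Y))%E.

Definition dominated_as_cvg (Yn : nat -> RV) (Y : RV) : Prop :=
  [/\ forall n, L (Yn n), L Y,
      {ae P, forall x, Yn n x @[n --> \oo] --> Y x} &
      exists2 Z : RV, L Z &
        forall n, {ae P, forall x, `|Yn n x| <= Z x}].

Definition upper_fatou (H : RV -> \bar R) : Prop :=
  forall (Yn : nat -> RV) (Y : RV), dominated_as_cvg Yn Y ->
    (limn_esup (fun n => H (Yn n)) <= H Y)%E.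

Definition lower_fatou (H : RV -> \bar R) : Prop :=
  forall (Yn : nat -> RV) (Y : RV), dominated_as_cvg Yn Y ->
    (H Y <= limn_einf (fun n => H (Yn n)))%E.

Definition dot (d : nat) (theta s : 'rV[R]_d.+1) : R :=
  \sum_(i < d.+1) theta 0 i * s 0 i.

Definition rv_dot (d : nat) (theta : 'rV[R]_d.+1) (X : 'I_d.+1 -> RV) : RV :=
  \sum_(i < d.+1) theta 0 i *: X i.

(* Linear independence and the value of the riskless asset are understood in
   the space L, in which almost surely equal random variables coincide. *)
Record market : Type := Market {
  risky : nat;
  rate : R;
  S0 : 'rV[R]_risky.+1;
  S1 : 'I_risky.+1 -> RV;
  market_S0 : forall i, S0 0 i = 1;
  market_rate : -1 < rate;
  market_riskless : as_eq (S1 ord0) (const_rv (1 + rate));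
  market_S1 : forall i, L (S1 i);
  market_arbitrage_free :
    ~ exists theta : 'rV[R]_risky.+1,
        [/\ dot theta S0 <= 0,
            as_le (const_rv 0) (rv_dot theta S1) &
            (0 < P [set x | (0 < rv_dot theta S1 x)%R])%E];
  market_non_redundant :
    forall theta : 'rV[R]_risky.+1,
      as_eq (rv_dot theta S1) (const_rv 0) -> theta = 0 }.

Section Selection.
Variable S : market.

Local Notation portfolio := 'rV[R]_(risky S).+1.

Definition payoff (theta : portfolio) : RV := rv_dot theta (@S1 S).

Definition zero_cost (eta : portfolio) : Prop :=
  eta != 0 /\ dot eta (S0 S) = 0.

Definition feasible (Rho : RV -> \bar R) (w Rmax : R) : set portfolio :=
  [set theta | dot theta (S0 S) = w /\ (Rho (payoff theta) <= Rmax%:E)%E].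

Definition admissible_bounds (Rho : RV -> \bar R) (w Rmax : R) : Prop :=
  0 < w /\ (Rho (const_rv (w * (1 + rate S))) <= Rmax%:E)%E.

Definition well_posed (U Rho : RV -> \bar R) : Prop :=
  forall w Rmax : R, admissible_bounds Rho w Rmax ->
    exists2 theta, feasible Rho w Rmax theta &
      forall theta', feasible Rho w Rmax theta' ->
        (U (payoff theta') <= U (payoff theta))%E.

Definition weakly_well_posed (U Rho : RV -> \bar R) : Prop :=
  forall w Rmax : R, admissible_bounds Rho w Rmax ->
    (ereal_sup [set U (payoff theta) | theta in feasible Rho w Rmax]
       < utility_at_infty U)%E.

Definition risk_SLL (Rho : RV -> \bar R) : Prop :=
  forall eta, zero_cost eta ->
    exists2 l0 : R, 0 < l0 &
      forall l : R, l0 < l -> (0 < Rho (l *: payoff eta))%E.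

Definition utility_robust_ASLL (U : RV -> \bar R) : Prop :=
  forall eta (Y : RV), zero_cost eta -> L Y ->
    exists2 e0 : R, 0 < e0 &
      forall e : R, 0 < e < e0 ->
        (limf_esup (fun l : R => U (l *: (payoff eta + e *: Y)))
           (pinfty_nbhs R) < utility_at_infty U)%E.

Definition utility_robust_SLL (U : RV -> \bar R) : Prop :=
  forall eta (Y : RV), zero_cost eta -> L Y ->
    exists e0 l0 : R, [/\ 0 < e0, 0 < l0 &
      forall l e : R, l0 < l -> 0 < e < e0 ->
        (U (l *: (payoff eta + e *: Y)) < 0)%E].

Definition aligned (U Rho : RV -> \bar R) : Prop :=
  forall eta, zero_cost eta ->
    (forall l : R, 0 < l -> (Rho (l *: payoff eta) <= 0)%E) ->
    U (l *: payoff eta) @[l --> +oo] --> utility_at_infty U.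

End Selection.
End Functionals.
End Setting.

(* Main.v *)
Require Import Defs.
From HB Require Import structures.
From mathcomp Require Import all_boot all_order all_algebra.
From mathcomp Require Import all_classical all_reals all_analysis.
From mathcomp Require Import measurable_realfun ess_sup_inf.
Set Implicit Arguments.
Unset Strict Implicit.
Unset Printing Implicit Defensive.
Import Order.TTheory GRing.Theory Num.Theory.
Import numFieldNormedType.Exports.
Local Open Scope classical_set_scope.
Local Open Scope ring_scope.

(* If portfolios of a fixed initial cost have norms tending to infinity, their
   normalizations accumulate at zero-cost portfolios eta of norm one.  A bound on
   the risk is inherited along the way, by star-shapedness and the lower Fatou
   property, as Rho (l * eta . S1) <= 0 for all l > 0, which SLL of Rho excludes.
   On the utility side, the terminal wealths are eventually dominated by
   l * (eta . S1 + e * Y) for every e > 0, where Y bounds the sum of the |S1 i|,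
   so that robust SLL or ASLL of U excludes large utilities far away.
   On a bounded set of portfolios, the upper Fatou property yields a maximizer.
   Conversely, if SLL of Rho fails, star-shapedness gives a direction eta with
   Rho (l * eta . S1) <= 0 for all l > 0; by cash-additivity and alignment, adding
   l * eta to the riskless portfolio is feasible and drives U to U(oo). *)

(** * Subsequences, and limits of extended real sequences *)

(** A cluster point [p] has, beyond every [n], an index whose term lies within [1/(n+1)] of [p];
    choosing one for each [n] gives [k]. The choice ensures only [n <= k n], which suffices to carry
    limits along [k]. *)
Lemma compact_seq_subsequence (R : realType) (X : pseudoMetricType R)
    (K : set X) (x : nat -> X) :
  compact K -> (forall n, K (x n)) ->
  exists2 p, K p & exists2 k : nat -> nat, (forall n, (n <= k n)%N) &
    x (k n) @[n --> \oo] --> p.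
Proof.
move=> cK Kx; have [|p [Kp clp]] := cK (x @ \oo) _; first by exists 0%N => // n _ /=; exact: Kx.
exists p => //.
have H n : exists k, (n <= k)%N /\ ball p (n.+1%:R^-1) (x k).
  have := clp [set x m | m in [set m | (n <= m)%N]] (ball p (n.+1%:R^-1)).
  case; first by exists n => // m /= nm; exists m.
    by apply: nbhsx_ballx; rewrite invr_gt0.
  by move=> _ [[m /= nm <-] pm]; exists m.
have [k kP] := choice H; exists k => [n|]; first by case: (kP n).
apply/cvg_ballP => e e0; have := near_infty_natSinv_lt (PosNum e0); apply: filterS => n /= ne.
by apply: le_ball (kP n).2; exact: ltW.
Qed.

Lemma le_limn_esup_cvg (R : realType) (u v : (\bar R)^nat) (c : \bar R) :
  (forall n, (u n <= v n)%E) -> u @ \oo --> c -> (c <= limn_esup v)%E.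
Proof.
move=> uv uc; rewrite /limn_esup limf_esupE; apply: le_ereal_inf_tmp => _ [V [N _ NV] <-].
apply: cvge_le uc.
near=> n; apply: (le_trans (uv n)); apply: ereal_sup_ubound; exists n => //.
apply: NV => /=; near: n; exact: nbhs_infty_ge.
Unshelve. all: by end_near. Qed.

(** Supplies levels for near-optimal choices: being strictly below a supremum [c], each [u n] is
    exceeded by some value of the set. *)
Lemma ereal_cvg_below (R : realType) (c : \bar R) : c != -oo%E ->
  exists2 u : (\bar R)^nat, (forall n, (u n < c)%E) & u @ \oo --> c.
Proof.
case: c => [r _||//].
- exists (fun n => (r - n.+1%:R^-1)%:E) => [n|].
    by rewrite lte_fin gtrBl invr_gt0.
  apply: cvg_EFin; first by apply: nearW.
  rewrite -[X in _ --> X]subr0; apply: cvgB; first exact: cvg_cst.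
  exact: cvg_harmonic.
- exists (fun n => n%:R%:E) => [n|]; first exact: ltry.
  exact/cvgenyP.
Qed.

Lemma limn_einf_le_cvg (R : realType) (u v : (\bar R)^nat) (c : \bar R) :
  (forall n, (v n <= u n)%E) -> u @ \oo --> c -> (limn_einf v <= c)%E.
Proof.
move=> vu uc; rewrite leeNl.
apply: (@le_limn_esup_cvg _ (fun n => - u n)%E) => [n|]; first by rewrite leeN2.
exact: cvgeN uc.
Qed.

(** * Linear combinations of random variables and the maximum norm of their coefficients *)

Section LinearCombinations.
Context d (T : measurableType d) (R : realType) (P : probability T R) (n : nat).
Implicit Types (theta eta : 'rV[R]_n.+1) (X : 'I_n.+1 -> {RV P >-> R}).

Lemma rv_dotE theta X t : rv_dot theta X t = \sum_(i < n.+1) theta 0 i * X i t.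
Proof. by rewrite /rv_dot; elim/big_rec2 : _ => // i y1 y2 _ <-. Qed.

Lemma rv_dot_linear (a : R) theta eta X :
  rv_dot (a *: theta + eta) X = a *: rv_dot theta X + rv_dot eta X.
Proof.
rewrite /rv_dot scaler_sumr -big_split; apply: eq_bigr => i _ /=.
by rewrite !mxE scalerDl scalerA.
Qed.

Lemma rv_dotZ (a : R) theta X : rv_dot (a *: theta) X = a *: rv_dot theta X.
Proof.
rewrite -[a *: theta]addr0 rv_dot_linear [rv_dot 0 X](_ : _ = 0) ?addr0//.
by rewrite /rv_dot big1// => i _; rewrite mxE scale0r.
Qed.

Lemma rv_dot_delta i X : rv_dot (delta_mx 0 i) X = X i.
Proof.
rewrite /rv_dot (bigD1 i)//= big1 ?addr0 ?mxE ?eqxx ?scale1r// => j ji.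
by rewrite mxE (negbTE ji) andbF scale0r.
Qed.

Lemma dot_linear (a : R) theta eta s :
  dot (a *: theta + eta) s = a * dot theta s + dot eta s.
Proof.
rewrite /dot mulr_sumr -big_split; apply: eq_bigr => i _ /=.
by rewrite !mxE mulrDl mulrA.
Qed.

Lemma dotZ (a : R) theta s : dot (a *: theta) s = a * dot theta s.
Proof.
by rewrite /dot mulr_sumr; apply: eq_bigr => i _; rewrite mxE mulrA.
Qed.

Lemma dot_delta i (s : 'rV[R]_n.+1) : dot (delta_mx 0 i) s = s 0 i.
Proof.
rewrite /dot (bigD1 i)//= big1 ?addr0 ?mxE ?eqxx ?mul1r// => j ji.
by rewrite mxE (negbTE ji) andbF mul0r.
Qed.

Lemma norm_coord_le theta i : `|theta 0 i| <= `|theta|.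
Proof.
by rewrite [leRHS]/Num.norm /= mx_normrE; apply/bigmax_geP; right; exists (0, i).
Qed.

Lemma cvg_linear_combination (theta_ : nat -> 'rV[R]_n.+1) theta (c : 'I_n.+1 -> R) :
  theta_ @ \oo --> theta ->
  \sum_(i < n.+1) theta_ k 0 i * c i @[k --> \oo] -->
  \sum_(i < n.+1) theta 0 i * c i.
Proof.
move=> h; apply: cvg_big => [|i _]; first exact: add_continuous.
apply: cvgM; last exact: cvg_cst.
move/cvgrPdist_lt : h => h; apply/cvgrPdist_lt => e /h; apply: filterS => k.
by apply: le_lt_trans; have := norm_coord_le (theta - theta_ k) i; rewrite !mxE.
Qed.

Lemma norm_rv_dot_le theta X t :
  `|rv_dot theta X t| <= `|theta| * \sum_(i < n.+1) `|X i t|.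
Proof.
rewrite rv_dotE; apply: le_trans (ler_norm_sum _ _ _) _.
rewrite mulr_sumr; apply: ler_sum => i _.
by rewrite normrM ler_wpM2r// norm_coord_le.
Qed.

Lemma compact_norm_le (M : R) : compact [set theta : 'rV[R]_n.+1 | `|theta| <= M].
Proof.
apply: bounded_closed_compact.
  exists M; split; first exact: num_real.
  by move=> x Mx theta /= /le_trans; apply; exact: ltW.
apply: (@preimage_closed _ _ (fun theta : 'rV[R]_n.+1 => `|theta|) [set x | x <= M]).
  by move=> x _; exact: norm_continuous.
exact: closed_le.
Qed.

End LinearCombinations.

(** * Constants, linear combinations and dominating variables in [L] *)

Section RandomVariableSpace.
Context d (T : measurableType d) (R : realType) (P : probability T R).
Variable L : set {RV P >-> R}.
Hypothesis hL : rv_space L.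

Lemma rv_space_const c : L (const_rv P c).
Proof.
apply: rv_space_Linfty hL _ _.
rewrite inE/=; apply/andP; split; rewrite inE//=.
rewrite /finite_norm unlock.
case: ifPn => // P0; rewrite (_ : _ \o _ = cst `|c|%:E) //.
by rewrite ess_sup_cst ?ltry.
Qed.

Lemma rv_space_linear a Y Z : L Y -> L Z -> L (a *: Y + Z).
Proof. by case: (rv_space_riesz hL) => -[_ h] _; exact: h. Qed.

Lemma rv_spaceZ a Y : L Y -> L (a *: Y).
Proof.
move=> LY; rewrite -[_ *: _]addr0; apply: rv_space_linear => //.
by case: (rv_space_riesz hL) => -[].
Qed.

Lemma rv_space_dot n (theta : 'rV[R]_n.+1) (X : 'I_n.+1 -> {RV P >-> R}) :
  (forall i, L (X i)) -> L (rv_dot theta X).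
Proof.
move=> LX; rewrite /rv_dot; elim/big_rec : _ => [|i Y _ LY].
  by case: (rv_space_riesz hL) => -[].
exact: rv_space_linear.
Qed.

(** The lattice supremum of [X i] and [- X i] dominates the absolute value of [X i] almost surely;
    the finitely many suprema are then added, as an [rv_dot] with unit coefficients. *)
Lemma rv_space_envelope n (X : 'I_n.+1 -> {RV P >-> R}) : (forall i, L (X i)) ->
  exists2 W, L W & {ae P, forall t, \sum_(i < n.+1) `|X i t| <= W t}.
Proof.
move=> LX.
have H i : exists W, L W /\ {ae P, forall t, `|X i t| <= W t}.
  have LN : L (-1 *: X i) by exact: rv_spaceZ.
  have [[W [LW XW NXW _]] _] := (rv_space_riesz hL).2 _ _ (LX i) LN.
  exists W; split => //; apply: filterS2 XW NXW => t /= XW NXW.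
  by rewrite ler_norml XW andbT lerNl -mulN1r.
have [W hW] := choice H; exists (rv_dot (const_mx 1) W).
  by apply: rv_space_dot => i; case: (hW i).
have : {ae P, forall t, forall i, `|X i t| <= W i t}.
  by apply: filter_forall => i; case: (hW i).
apply: filterS => t ht; rewrite rv_dotE; apply: ler_sum => i _.
by rewrite mxE mul1r.
Qed.

End RandomVariableSpace.

(** * Escaping sequences *)

(** The alternative from which the later boundedness arguments start. [A] may vary with [n] so that
    utility levels can approach [U(oo)] while the norms grow. *)
Lemma unbounded_sequence (R : realType) (V : normedModType R) (A : nat -> set V) :
  (exists n : nat, forall x, A n x -> `|x| <= n.+1%:R) \/
  (exists x_ : nat -> V, forall n, A n (x_ n) /\ n.+1%:R < `|x_ n|).
Proof.
have [h|h] := pselect (exists n : nat, forall x, A n x -> `|x| <= n.+1%:R); first by left.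
right; have H n : exists x, A n x /\ n.+1%:R < `|x|.
  apply: contrapT => hn; apply: h; exists n => x Ax.
  by rewrite leNgt; apply/negP => nx; apply: hn; exists x.
by have [x_ hx] := choice H; exists x_.
Qed.

Lemma cvg_subsequence (X : topologicalType) (u : nat -> X) (p : X) (k : nat -> nat) :
  (forall n, (n <= k n)%N) -> u @ \oo --> p -> u (k n) @[n --> \oo] --> p.
Proof.
move=> kn up; apply: cvg_comp up => A [N _ NA].
by exists N => // n /= Nn; apply: NA => /=; exact: leq_trans (kn n).
Qed.

(** * Fatou properties along convergent portfolios, and existence of maximizers *)

Section Portfolios.
Context d (T : measurableType d) (R : realType) (P : probability T R).
Variables (L : set {RV P >-> R}) (S : market L).
Hypothesis hL : rv_space L.
Local Notation portfolio := 'rV[R]_(risky S).+1.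
Implicit Types theta eta : portfolio.

Lemma payoff_mem theta : L (payoff theta).
Proof. by apply: rv_space_dot => // i; exact: market_S1. Qed.

Lemma payoff_riskless (w : R) :
  as_eq (payoff (w *: delta_mx 0 0 : portfolio)) (const_rv P (w * (1 + rate S))).
Proof.
rewrite /payoff rv_dotZ rv_dot_delta; apply: filterS (market_riskless S) => t ht.
by rewrite /= -[X in _ = w * X]ht.
Qed.

Lemma cvg_dot (theta_ : nat -> portfolio) theta s :
  theta_ @ \oo --> theta -> dot (theta_ n) s @[n --> \oo] --> dot theta s.
Proof. exact: cvg_linear_combination. Qed.

(** A convergent sequence of portfolios is bounded by some [M], so [M] times an envelope of the
    assets dominates all payoffs. This makes both Fatou properties applicable. *)
Lemma payoff_dominated_cvg (theta_ : nat -> portfolio) theta :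
  theta_ @ \oo --> theta ->
  dominated_as_cvg L (fun n => payoff (theta_ n)) (payoff theta).
Proof.
move=> h; split => [n||| ]; [exact: payoff_mem|exact: payoff_mem| |].
  apply: aeW => t; rewrite /payoff rv_dotE.
  under eq_fun do rewrite rv_dotE.
  exact: cvg_linear_combination.
have /cvg_seq_bounded/pinfty_ex_gt0[M M0 hM] : cvgn theta_ by apply/cvg_ex; exists theta.
have [W LW hW] := rv_space_envelope hL (@market_S1 _ _ _ _ _ S).
exists (M *: W) => [|n]; first exact: rv_spaceZ.
apply: filterS hW => t hW; apply: le_trans (norm_rv_dot_le _ _ _) _.
apply: ler_pM => //; first by apply: sumr_ge0 => i _.
exact: hM.
Qed.

Lemma risk_as_eq (Rho : {RV P >-> R} -> \bar R) Y Z : risk_functional L Rho ->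
  L Y -> L Z -> as_eq Y Z -> Rho Y = Rho Z.
Proof.
move=> hR LY LZ YZ; apply/eqP; rewrite eq_le; apply/andP; split;
  by apply: risk_decreasing hR _ _ _ _ _ => //; apply: filterS YZ => t ->.
Qed.

Lemma lower_fatou_payoff Rho (theta_ : nat -> portfolio) theta u (c : \bar R) :
  lower_fatou L Rho -> theta_ @ \oo --> theta ->
  (forall n, (Rho (payoff (theta_ n)) <= u n)%E) -> u @ \oo --> c ->
  (Rho (payoff theta) <= c)%E.
Proof.
move=> hF h hu uc; apply: le_trans (hF _ _ (payoff_dominated_cvg h)) _.
exact: limn_einf_le_cvg uc.
Qed.

Lemma upper_fatou_payoff U (theta_ : nat -> portfolio) theta u (c : \bar R) :
  upper_fatou L U -> theta_ @ \oo --> theta ->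
  (forall n, (u n <= U (payoff (theta_ n)))%E) -> u @ \oo --> c ->
  (c <= U (payoff theta))%E.
Proof.
move=> hF h hu uc; apply: le_trans (hF _ _ (payoff_dominated_cvg h)).
exact: le_limn_esup_cvg uc.
Qed.

(** The direct method: a maximizing sequence has a convergent subsequence with limit in [C], and the
    upper Fatou property gives the limit at least the supremum. If the supremum is [-oo], every
    point of [C] is a maximizer. *)
Lemma upper_fatou_maximizer U (C : set portfolio) (M : R) :
  upper_fatou L U -> C !=set0 -> (forall theta, C theta -> `|theta| <= M) ->
  (forall (theta_ : nat -> portfolio) theta,
    (forall n, C (theta_ n)) -> theta_ @ \oo --> theta -> C theta) ->
  exists2 theta, C theta &
    forall theta', C theta' -> (U (payoff theta') <= U (payoff theta))%E.
Proof.
move=> hF [theta0 C0] CM Ccl.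
pose s := ereal_sup [set U (payoff theta) | theta in C].
have sC theta : C theta -> (U (payoff theta) <= s)%E.
  by move=> Ct; apply: ereal_sup_ubound; exists theta.
have [sNy|/ereal_cvg_below[u us u_s]] := eqVneq s -oo%E.
  by exists theta0 => // theta /sC; rewrite sNy leeNy_eq => /eqP ->; exact: leNye.
have H n : exists theta, C theta /\ (u n <= U (payoff theta))%E.
  by have [_ [theta Ct <-] /ltW] := ereal_sup_gt (us n); exists theta.
have [theta_ hth] := choice H.
have [p _ [k kn kp]] := compact_seq_subsequence (@compact_norm_le R (risky S) M)
  (fun n => CM _ (hth n).1).
exists p; first by apply: Ccl kp => n; exact: (hth _).1.
move=> theta' /sC /le_trans; apply.
apply: upper_fatou_payoff kp (fun n => (hth (k n)).2) _ => //.
exact: cvg_subsequence.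
Qed.

(** * Limit directions of escaping portfolios *)

(** The normalizations have norm one, so a limit point is non-zero; their costs are [w] divided by
    norms tending to infinity, so it costs zero. *)
Lemma normalized_subsequence (theta_ : nat -> portfolio) (w : R) :
  (forall n, dot (theta_ n) (S0 S) = w) -> (forall n, n.+1%:R < `|theta_ n|) ->
  exists2 eta, zero_cost eta & exists2 k : nat -> nat, (forall n, (n <= k n)%N) &
    `|theta_ (k n)|^-1 *: theta_ (k n) @[n --> \oo] --> eta.
Proof.
move=> hw hn.
have n0 n : 0 < `|theta_ n| by exact: le_lt_trans (hn n).
pose z n := `|theta_ n|^-1 *: theta_ n.
have z1 n : `|z n| = 1.
  by rewrite normrZ normfV normr_id mulVf// gt_eqF.
have [|p _ [k kn kp]] := compact_seq_subsequence (@compact_norm_le R (risky S) 1) (x := z).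
  by move=> n; change (`|z n| <= 1); rewrite z1.
exists p; last by exists k.
split.
  rewrite -normr_eq0; suff -> : `|p| = 1 by exact: oner_neq0.
  have /cvg_norm h := kp; apply: (cvg_unique _ h) => //.
  rewrite (_ : (fun n => `|z (k n)|) = cst 1); first exact: cvg_cst.
  by apply/funext => n; exact: z1.
have h := cvg_dot (s := S0 S) kp; apply: (cvg_unique _ h) => //.
rewrite (_ : (fun n => dot _ _) = fun n => `|theta_ (k n)|^-1 * w); last first.
  by apply/funext => n; rewrite dotZ hw.
suff : `|theta_ (k n)|^-1 * w @[n --> \oo] --> 0 * w by rewrite mul0r.
apply: cvgM; last exact: cvg_cst.
apply: (squeeze_cvgr _ (cvg_cst 0) cvg_harmonic).
apply: nearW => n; rewrite invr_ge0 ltW//= lef_pV2 ?posrE//.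
by apply/ltW/(le_lt_trans _ (hn _)); rewrite ler_nat ltnS.
Qed.

(** Once a normalized portfolio is within [e] of [eta], their payoffs differ by at most [e] times
    the envelope [Y] of the assets. [Y] is chosen before [e], as the robust conditions require. *)
Lemma payoff_le_scaled_direction (theta_ : nat -> portfolio) (w : R) :
  (forall n, dot (theta_ n) (S0 S) = w) -> (forall n, n.+1%:R < `|theta_ n|) ->
  exists eta Y, [/\ zero_cost eta, L Y & forall (e : R) (N : nat), 0 < e ->
    exists2 n, (N <= n)%N &
      as_le (payoff (theta_ n)) (`|theta_ n| *: (payoff eta + e *: Y))].
Proof.
move=> hw hn; have [eta eta0 [k kn kp]] := normalized_subsequence hw hn.
have [W LW hW] := rv_space_envelope hL (@market_S1 _ _ _ _ _ S).
exists eta, W; split => // e N e0.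
move/cvgrPdist_lt : kp => /(_ _ e0)[N' _ /(_ (maxn N N'))] /=.
rewrite leq_maxr => /(_ isT); set m := k _ => hm.
exists m; first by apply: leq_trans (kn _); exact: leq_maxl.
have m0 : 0 < `|theta_ m| by exact: le_lt_trans (hn m).
apply: filterS hW => t hW.
pose z := `|theta_ m|^-1 *: theta_ m.
have -> : payoff (theta_ m) t = `|theta_ m| * payoff z t.
  by rewrite /payoff /z rv_dotZ /= mulrA divff ?mul1r// gt_eqF.
rewrite /= ler_wpM2l// -lerBlDl.
have -> : payoff z t - payoff eta t = rv_dot (-1 *: eta + z) (@S1 _ _ _ _ _ S) t.
  by rewrite rv_dot_linear scaleN1r addrC.
apply: le_trans (ler_norm _) _; apply: le_trans (norm_rv_dot_le _ _ _) _.
apply: ler_pM => //; first by apply: sumr_ge0 => i _.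
by rewrite scaleN1r addrC distrC ltW.
Qed.

(** Star-shapedness applied to [b *: Y] with the factor [b^-1 > 1]. *)
Lemma star_shaped_scale Rho Y (b k : R) : positively_star_shaped L Rho -> L Y ->
  0 < b <= 1 -> (Rho Y <= k%:E)%E -> (Rho (b *: Y) <= (b * k)%:E)%E.
Proof.
move=> hRs LY /andP[b0]; rewrite le_eqVlt => /predU1P[->|b1] Yk.
  by rewrite scale1r mul1r.
have /= := hRs (b *: Y) b^-1 (rv_spaceZ hL b LY).
rewrite invf_gt1// => /(_ b1); rewrite scalerA mulVf ?gt_eqF// scale1r => h.
by have := le_trans h Yk; rewrite lee_pdivrMl.
Qed.

(** * Consequences of the large-loss conditions for large portfolios *)

(** Along an escaping sequence, scaling by [l] over the norm brings the risk bound [k] down to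
    [l * k] over the norm, which tends to zero. Lower Fatou then gives the limit direction, scaled
    by [l], risk at most zero, against SLL. *)
Lemma risk_SLL_bounded Rho (w k : R) : positively_star_shaped L Rho -> lower_fatou L Rho ->
  risk_SLL S Rho ->
  exists M : R, forall theta, dot theta (S0 S) = w -> (Rho (payoff theta) <= k%:E)%E ->
    `|theta| <= M.
Proof.
move=> hRs hRF sll.
have [[n hn]|[theta_ hth]] := unbounded_sequence
  (fun=> [set theta | dot theta (S0 S) = w /\ (Rho (payoff theta) <= k%:E)%E]).
  by exists n.+1%:R => theta ? ?; exact: hn.
exfalso.
have hn n : n.+1%:R < `|theta_ n| by case: (hth n).
have [eta eta0 [j jn jp]] := normalized_subsequence (fun n => (hth n).1.1) hn.
have [l0 l00 hl] := sll _ eta0.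
(* The shift by [N] makes every norm at least [l], so that the scaling factor lies in [(0,1]] from
   the first index on. *)
pose l := l0 + 1; pose N := (Num.truncn l).+1.
have lN n : l <= `|theta_ (j (n + N)%N)|.
  apply/ltW/(lt_le_trans (truncnS_gt l))/ltW/(le_lt_trans _ (hn _)).
  by rewrite ler_nat ltnW// ltnS (leq_trans _ (jn _))// leq_addl.
have l_gt0 : 0 < l by rewrite /l addr_gt0.
have := hl l; rewrite ltrDl ltr01 => /(_ isT); rewrite ltNge => /negP; apply.
rewrite /payoff -rv_dotZ.
pose z n := l *: (`|theta_ (j (n + N)%N)|^-1 *: theta_ (j (n + N)%N)).
(* The absolute value covers negative [k], for which a larger norm weakens the bound. *)
apply: (@lower_fatou_payoff _ z _ (fun n => (l * `|k| * n.+1%:R^-1)%:E)) => //.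
- apply: cvgZr.
  by move: jp; rewrite -(cvg_shiftn N).
- move=> n; rewrite /z scalerA /payoff rv_dotZ.
  have t0 : 0 < `|theta_ (j (n + N)%N)| by exact: lt_le_trans (lN n).
  apply: le_trans (@star_shaped_scale _ _ _ k hRs (payoff_mem _) _ (hth _).1.2) _.
    by rewrite divr_gt0//= ler_pdivrMr// mul1r.
  rewrite lee_fin -!mulrA ler_pM2l// [leRHS]mulrC.
  apply: le_trans (ler_wpM2l _ (ler_norm k)) _; rewrite ?invr_ge0// ler_wpM2r//.
  rewrite lef_pV2 ?posrE//; apply/ltW/(le_lt_trans _ (hn _)).
  by rewrite ler_nat ltnS (leq_trans _ (jn _))// leq_addr.
- apply: cvg_EFin; first exact: nearW.
  suff : l * `|k| * n.+1%:R^-1 @[n --> \oo] --> l * `|k| * 0 by rewrite mulr0.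
  by apply: cvgM; [exact: cvg_cst|exact: cvg_harmonic].
Qed.

(** An escaping sequence would have a term dominated by the perturbed direction at scale [l] equal
    to its norm; there robust SLL makes the utility negative. *)
Lemma utility_robust_SLL_bounded U (w : R) : utility_functional L U ->
  utility_robust_SLL S U ->
  exists M : R, forall theta, dot theta (S0 S) = w -> (0 <= U (payoff theta))%E ->
    `|theta| <= M.
Proof.
move=> hU sll.
have [[n hn]|[theta_ hth]] := unbounded_sequence
  (fun=> [set theta | dot theta (S0 S) = w /\ (0 <= U (payoff theta))%E]).
  by exists n.+1%:R => theta ? ?; exact: hn.
exfalso.
have hn n : n.+1%:R < `|theta_ n| by case: (hth n).
have [eta [Y [eta0 LY dom]]] := payoff_le_scaled_direction (fun n => (hth n).1.1) hn.
have [e0 [l0 [e00 l00 hl]]] := sll _ _ eta0 LY.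
have [n Nn le] := dom (e0 / 2) (Num.truncn l0).+1 (divr_gt0 e00 (ltr0Sn _ 1)).
have := (hth n).1.2; rewrite leNgt => /negP; apply.
apply: le_lt_trans (utility_increasing hU (payoff_mem _) _ le) _.
  by apply: rv_spaceZ => //; rewrite addrC; apply: rv_space_linear => //; exact: payoff_mem.
apply: hl; last by rewrite divr_gt0//= ltr_pdivrMr// ltr_pMr// ltr1n.
apply/(lt_le_trans (truncnS_gt l0))/ltW/(le_lt_trans _ (hn _)).
by rewrite ler_nat ltnW.
Qed.

(** Otherwise some escaping portfolios have utilities above levels [u n] tending to [U(oo)], while
    domination by a perturbed direction keeps utilities infinitely often below a fixed level under
    [U(oo)]. *)
Lemma utility_robust_ASLL_far U (w : R) : utility_functional L U ->
  utility_robust_ASLL S U ->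
  exists (M : R) (m : \bar R), (m < utility_at_infty U)%E /\
    forall theta, dot theta (S0 S) = w -> M < `|theta| -> (U (payoff theta) <= m)%E.
Proof.
move=> hU sll.
have [u us u_s] : exists2 u : (\bar R)^nat, (forall n, (u n < utility_at_infty U)%E) &
    u @ \oo --> utility_at_infty U.
  apply: ereal_cvg_below; rewrite gt_eqF//.
  by apply: le_lt_trans (utility_lt_infty hU (rv_space_const hL 0)); exact: leNye.
have [[n hn]|[theta_ hth]] := unbounded_sequence (fun n =>
    [set theta | dot theta (S0 S) = w /\ (u n < U (payoff theta))%E]).
  exists n.+1%:R, (u n); split => // theta tw Mt; rewrite leNgt; apply/negP => ut.
  by have := hn theta (conj tw ut); rewrite leNgt Mt.
exfalso.
have hn n : n.+1%:R < `|theta_ n| by case: (hth n).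
have [eta [Y [eta0 LY dom]]] := payoff_le_scaled_direction (fun n => (hth n).1.1) hn.
have [e0 e00 hl] := sll _ _ eta0 LY.
have e2 : 0 < e0 / 2 < e0 by rewrite divr_gt0//= ltr_pdivrMr// ltr_pMr// ltr1n.
(* The limit superior is an infimum over neighbourhoods of infinity, so on one of them the supremum
   [s] is already below [U(oo)]. *)
have := hl _ e2; rewrite limf_esupE => /ereal_inf_lt[_ [V [l0 [_ Vl0]] <-]].
set s := ereal_sup _ => sU.
have [N _ hN] : \forall n \near \oo, (s < u n)%E.
  suff : nbhs (utility_at_infty U) [set y | (s < y)%E] by exact: u_s.
  by apply: open_nbhs_nbhs; split => //; exact: open_ereal_gt_ereal.
have [n Nn le] := dom (e0 / 2) (maxn N (Num.truncn l0).+1) (divr_gt0 e00 (ltr0Sn _ 1)).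
have := hN n (leq_trans (leq_maxl _ _) Nn); rewrite ltNge => /negP; apply.
apply: (le_trans (ltW (hth n).1.2)).
apply: le_trans (utility_increasing hU (payoff_mem _) _ le) _.
  by apply: rv_spaceZ => //; rewrite addrC; apply: rv_space_linear => //; exact: payoff_mem.
apply: ereal_sup_ubound; exists `|theta_ n| => //; apply: Vl0.
apply/(lt_le_trans (truncnS_gt l0))/ltW/(le_lt_trans _ (hn _)).
by rewrite ler_nat ltnW// ltnS (leq_trans _ Nn)// leq_maxr.
Qed.

(** * Feasible portfolios and well-posedness *)

Lemma risky_rate_gt0 : 0 < 1 + rate S.
Proof. by have := market_rate S; rewrite -ltrBlDl sub0r. Qed.

(** The admissible [Rmax] are exactly those that investing all of [w] without risk respects; hence
    the feasible set is non-empty. *)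
Lemma feasible_riskless Rho (w Rmax : R) : risk_functional L Rho ->
  admissible_bounds S Rho w Rmax -> feasible Rho w Rmax (w *: delta_mx 0 0 : portfolio).
Proof.
move=> hR [w0 wR]; split; first by rewrite dotZ dot_delta market_S0 mulr1.
rewrite (risk_as_eq hR _ _ (payoff_riskless w)) //; first exact: payoff_mem.
exact: rv_space_const.
Qed.

Lemma feasible_closed Rho (w Rmax : R) (theta_ : nat -> portfolio) theta :
  lower_fatou L Rho -> (forall n, feasible Rho w Rmax (theta_ n)) ->
  theta_ @ \oo --> theta -> feasible Rho w Rmax theta.
Proof.
move=> hRF hth h; split.
  have := cvg_dot (s := S0 S) h; under eq_fun do rewrite (hth _).1.
  by move/cvg_unique; apply => //; exact: cvg_cst.
apply: (lower_fatou_payoff hRF h (fun n => (hth n).2)); exact: cvg_cst.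
Qed.

Lemma well_posed_weakly U Rho : utility_functional L U ->
  well_posed S U Rho -> weakly_well_posed S U Rho.
Proof.
move=> hU wp w Rmax /wp[theta _ max].
apply: le_lt_trans (utility_lt_infty hU (payoff_mem theta)).
by apply: ge_ereal_sup => _ [theta' /max ? <-].
Qed.

Lemma risk_SLL_well_posed U Rho : upper_fatou L U -> risk_functional L Rho ->
  positively_star_shaped L Rho -> lower_fatou L Rho ->
  risk_SLL S Rho -> well_posed S U Rho.
Proof.
move=> hUF hR hRs hRF sll w Rmax wR.
have [M hM] := risk_SLL_bounded w Rmax hRs hRF sll.
apply: (@upper_fatou_maximizer _ _ M) => //.
- by exists (w *: delta_mx 0 0); exact: feasible_riskless.
- by move=> theta [? ?]; exact: hM.
- by move=> theta_ theta; exact: feasible_closed.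
Qed.

Lemma utility_robust_SLL_well_posed U Rho : utility_functional L U -> normalized U ->
  upper_fatou L U -> risk_functional L Rho -> lower_fatou L Rho ->
  utility_robust_SLL S U -> well_posed S U Rho.
Proof.
move=> hU hU0 hUF hR hRF sll w Rmax wR.
have [M hM] := utility_robust_SLL_bounded w hU sll.
pose th0 : portfolio := w *: delta_mx 0 0.
have Uth0 : (0 <= U (payoff th0))%E.
  rewrite -hU0; apply: utility_increasing hU _ _ _ _ _; [exact: rv_space_const|exact: payoff_mem|].
  apply: filterS (payoff_riskless w) => t ->.
  by rewrite /= mulr_ge0// ltW// ?risky_rate_gt0//; case: wR.
(* The feasible set itself may be unbounded. The portfolios left out have negative utility, so a
   maximizer on [C] beats them too. *)
pose C := [set theta : portfolio | feasible Rho w Rmax theta /\ (0 <= U (payoff theta))%E].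
have [||theta_ theta hth h|theta [ft Ut] max] := @upper_fatou_maximizer U C M hUF.
- by exists th0; split => //; exact: feasible_riskless.
- by move=> theta [[? _] ?]; exact: hM.
- split; first by apply: feasible_closed h => // n; exact: (hth n).1.
  apply: (upper_fatou_payoff hUF h (fun n => (hth n).2)); exact: cvg_cst.
exists theta => // theta' ft'.
have [U0|U0] := leP 0%E (U (payoff theta')); first exact: max.
exact: le_trans (ltW U0) Ut.
Qed.

Lemma utility_robust_ASLL_weakly_well_posed U Rho : utility_functional L U ->
  upper_fatou L U -> risk_functional L Rho -> lower_fatou L Rho ->
  utility_robust_ASLL S U -> weakly_well_posed S U Rho.
Proof.
move=> hU hUF hR hRF sll w Rmax wR.
have [M [m [mU hM]]] := utility_robust_ASLL_far w hU sll.
pose th0 : portfolio := w *: delta_mx 0 0.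
(* Enlarging [M] keeps the riskless portfolio in [C]. Beyond [M'] utilities are at most [m]; within
   it the maximum is attained, hence below [U(oo)]. *)
pose M' := Num.max M `|th0|.
pose C := [set theta : portfolio | feasible Rho w Rmax theta /\ `|theta| <= M'].
have [||theta_ theta hth h|theta [ft Ut] max] := @upper_fatou_maximizer U C M' hUF.
- by exists th0; split; [exact: feasible_riskless|rewrite /M' le_max lexx orbT].
- by move=> theta [].
- split; first by apply: feasible_closed h => // n; exact: (hth n).1.
  apply: (closed_cvg (fun x : R => x <= M') (@closed_le _ _) _ _ (cvg_norm h)).
  apply: nearW => n; exact: (hth n).2.
apply: (@le_lt_trans _ _ (maxe m (U (payoff theta)))); last first.
  by rewrite gt_max mU (utility_lt_infty hU (payoff_mem _)).
apply: ge_ereal_sup => _ [theta' ft' <-]; rewrite le_max.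
have [tM|tM] := leP `|theta'| M'; first by rewrite max ?orbT.
by rewrite hM//; [case: ft'|apply: le_lt_trans tM; rewrite /M' le_max lexx].
Qed.

(** If SLL fails for [eta], alignment drives the utility of its multiples to [U(oo)]; adding them to
    the riskless portfolio respects the risk bound and contradicts weak well-posedness. *)
Lemma aligned_weakly_well_posed_SLL U Rho : utility_functional L U ->
  risk_functional L Rho -> cash_additive L Rho -> positively_star_shaped L Rho ->
  aligned S U Rho -> weakly_well_posed S U Rho -> risk_SLL S Rho.
Proof.
move=> hU hR hRc hRs al wwp eta eta0; apply: contrapT => nsll.
have LX (l : R) : L (l *: payoff eta) by apply: rv_spaceZ => //; exact: payoff_mem.
(* By star-shapedness, positive risk at one scale [l] would persist at all larger scales, and [l]
   would witness SLL for [eta]. *)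
have R0 l : 0 < l -> (Rho (l *: payoff eta) <= 0)%E.
  move=> l0; rewrite leNgt; apply/negP => Rl; apply: nsll; exists l => // l' ll'.
  rewrite ltNge; apply/negP => Rl'; move: Rl; rewrite ltNge => /negP; apply.
  have l'0 := lt_trans l0 ll'.
  have -> : l *: payoff eta = (l / l') *: (l' *: payoff eta).
    by rewrite scalerA divfK// gt_eqF.
  have := @star_shaped_scale _ _ (l / l') 0 hRs (LX l') _ Rl'; rewrite mulr0; apply.
  by rewrite divr_gt0//= ler_pdivrMr// mul1r ltW.
have Ucvg := al _ eta0 R0.
have Rfin := risk_const_fin hR risky_rate_gt0.
(* The tightest admissible bound for [w = 1]: by cash-additivity it is still met after adding a
   position of risk at most zero. *)
have wR : admissible_bounds S Rho 1 (fine (Rho (const_rv P (1 + rate S)))).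
  by split => //; rewrite mul1r fineK.
have supU := wwp _ _ wR; set s := ereal_sup _ in supU.
have : \forall l \near +oo, (s < U (l *: payoff eta))%E.
  suff : nbhs (utility_at_infty U) [set y | (s < y)%E] by exact: Ucvg.
  by apply: open_nbhs_nbhs; split => //; exact: open_ereal_gt_ereal.
case/pinfty_ex_gt0 => l l0; rewrite /= ltNge => /negP; apply.
pose th0 : portfolio := 1 *: delta_mx 0 0.
pose theta := l *: eta + th0.
have thetaE : payoff theta = l *: payoff eta + payoff th0 by exact: rv_dot_linear.
have : as_eq (payoff th0) (const_rv P (1 * (1 + rate S))) by exact: payoff_riskless.
rewrite mul1r => cash.
(* The riskless part adds [1 + rate S > 0] to the wealth, so utility does not drop. *)
apply: (@le_trans _ _ (U (payoff theta))).
  apply: utility_increasing hU _ _ _ _ _ => //; first exact: payoff_mem.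
  rewrite thetaE; apply: filterS cash => t ht /=.
  by rewrite lerDl ht /= ltW// risky_rate_gt0.
apply: ereal_sup_ubound; exists theta => //; split.
  by rewrite dot_linear eta0.2 mulr0 add0r /th0 dotZ dot_delta market_S0 mul1r.
rewrite fineK//.
rewrite (@risk_as_eq _ _ (l *: payoff eta + const_rv P (1 + rate S)) hR).
- by rewrite hRc// geeDr// R0.
- exact: payoff_mem.
- by apply: rv_space_linear => //; [exact: payoff_mem|exact: rv_space_const].
- by rewrite thetaE; apply: filterS cash => t; exact: (congr1 (+%R _)).
Qed.

End Portfolios.

(** * Combining the implications *)

Theorem theorem4p2 (dT : measure_display) (T : measurableType dT)
  (R : realType) (P : probability T R) (hP : atomless P)
  (L : set {RV P >-> R}) (hL : rv_space L)
  (S : market L)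
  (U : {RV P >-> R} -> \bar R) (hU : utility_functional L U)
  (hU0 : normalized U) (hUF : upper_fatou L U)
  (Rho : {RV P >-> R} -> \bar R) (hR : risk_functional L Rho)
  (hRc : cash_additive L Rho) (hRs : positively_star_shaped L Rho)
  (hRF : lower_fatou L Rho) :
  let a := utility_robust_ASLL S U \/ risk_SLL S Rho in
  let b := weakly_well_posed S U Rho in
  let c := utility_robust_SLL S U \/ risk_SLL S Rho in
  let d := well_posed S U Rho in
  [/\ a -> b, c -> d &
      aligned S U Rho -> [/\ a <-> b, a <-> c & a <-> d]].
Proof.
move=> a b c d.
have ab : a -> b.
  case=> [sll|sll]; first exact: utility_robust_ASLL_weakly_well_posed.
  by apply: well_posed_weakly => //; exact: risk_SLL_well_posed.
have cd : c -> d.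
  by case=> [sll|sll]; [exact: utility_robust_SLL_well_posed|exact: risk_SLL_well_posed].
have db : d -> b by exact: well_posed_weakly.
split => // al.
(* SLL of [Rho] is a disjunct of both [a] and [c], so the implications needed for the equivalences
   pass through it. *)
have bsll : b -> risk_SLL S Rho by exact: aligned_weakly_well_posed_SLL.
have ba : b -> a by move/bsll; right.
split; split => //.
- by move/ab/bsll; right.
- by move/cd/db.
- by move/ab/bsll/risk_SLL_well_posed; apply.
- by move/db.
Qed.
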